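(* Let $k=2n$ be a fixed even positive integer. For all real $x \ge k+1$ the following double inequality holds: $$r_{k}(x) \;<\; \frac{\operatorname{Re} A(x)}{\Gamma(x+2)} \;\le\; \frac{p_{k}(x)}{p_{k}(x)-1}\cdot r_{k}(x),$$ and equality (in the right-hand inequality) holds for $x=k+1$.
   Context: For real $x>-2$ the alternating Kurepa function is given by $$A(x)=\int_0^\infty e^{-t}\,\frac{t^{x+1}-(-1)^{x}t}{t+1}\,dt,\qquad (-1)^x=e^{i\pi x},$$ so that $$\operatorname{Re}A(x)=\int_0^\infty e^{-t}\,\frac{t^{x+1}-\cos(\pi x)\,t}{t+1}\,dt .$$ The polynomials $p_m$ are defined by $p_0(z)=1$ and $p_m(z)=(z-m+1)\,p_{m-1}(z)+(-1)^m$ for $m\ge 1$. The rational functions $r_m(z)$ (defined for $z\in\mathbb{C}\setminus\{-1,0,1,\ldots,m-2\}$, this set being $\{-1\}$ for $m=1$) are given by $r_1(z)=-\frac{1}{z+1}$, $r_2(z)=\frac{z-1}{z(z+1)}$ and, for $m\ge3$, $$r_m(z)=-\frac{z-m+1}{z-m+2}\,r_{m-1}(z)+\frac{1}{z-m+2}\,r_{m-2}(z).$$ *)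

(* Defs.v *)
From Stdlib Require Import Reals Lra.
From Coquelicot Require Import Coquelicot.

Open Scope R_scope.

Definition Cexp (z : C) : C :=
  (exp (Re z) * cos (Im z), exp (Re z) * sin (Im z)).

(* The branch (-1)^x = e^{i pi x}. *)
Definition neg1_pow (x : R) : C := Cexp (Cmult Ci (RtoC (PI * x))).

(* Integrals over (0, +oo) are improper at both ends: t^s is only used for
   t > 0, where it is Rpower t s, and it may be unbounded near 0.  RInt_gen is
   total; its value is meaningful only when the improper integral converges,
   which it does for x > -2 in Kurepa_A and for z > 0 in Gamma. *)

Definition Kurepa_A (x : R) : C :=
  RInt_gen (V := C_R_CompleteNormedModule)
    (fun t : R =>
       Cdiv (Cmult (RtoC (exp (- t)))
                   (Cminus (RtoC (Rpower t (x + 1)))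
                           (Cmult (neg1_pow x) (RtoC t))))
            (RtoC (t + 1)))
    (at_right 0) (Rbar_locally p_infty).

Definition Gamma (z : R) : R :=
  RInt_gen (fun t : R => Rpower t (z - 1) * exp (- t))
    (at_right 0) (Rbar_locally p_infty).

(* p_m and r_m at real arguments, where their values are real. *)

Fixpoint p (m : nat) (z : R) : R :=
  match m with
  | O => 1
  | S m' => (z - INR m + 1) * p m' z + (-1) ^ m
  end.

(* Indices start at 1: the value at 0 is a dummy.  The recurrence is used for
   m >= 3.  For z in {-1, 0, ..., m - 2} the value is unspecified. *)
Fixpoint r (m : nat) (z : R) : R :=
  match m with
  | O => 0
  | S m1 =>
      match m1 with
      | O => - (1 / (z + 1))
      | S O => (z - 1) / (z * (z + 1))
      | S m2 =>
          - ((z - INR m + 1) / (z - INR m + 2)) * r m1 z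
          + 1 / (z - INR m + 2) * r m2 z
      end
  end.

(* Main.v *)
Require Import Defs.
From Stdlib Require Import Reals Lra Lia.
From Coquelicot Require Import Coquelicot.

(** Adding the integrands of [Re A(x)] and [Re A(x-1)] cancels both the
    denominator [t+1] and the cosine, so [Re A(x) + Re A(x-1) = Gamma(x+1)].
    Unrolling this [m] times expresses [Re A(x)] as an alternating sum of the
    values [Gamma(x+1), ..., Gamma(x+2-m)] plus [(-1)^m Re A(x-m)].  The
    polynomials [p] and the functions [r] are two normalizations of that sum:
    it equals [Gamma(x+2-m) p_{m-1}(x)] ([Re_A_unroll]) and
    [(-1)^m r_m(x) Gamma(x+2)] ([r_Gamma]).  For [m = k] even and [y = x-k >= 1]
    one gets
<<
      Re A(x) = r_k(x) Gamma(x+2) + Re A(y),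
      p_k(x) / (p_k(x) - 1) * r_k(x) Gamma(x+2)
              = r_k(x) Gamma(x+2) + Gamma(y+1)
              = Re A(x) + Re A(y-1),
>>
    the second because [p_k(x) - 1 = (y+1) p_{k-1}(x)] and
    [Gamma(y+2) = (y+1) Gamma(y+1)].  The lower bound therefore says
    [Re A(y) > 0], the upper bound says [Re A(y-1) >= 0], and equality at
    [x = k+1] says [Re A(0) = 0], which is clear from the integrand.

    Everything rests on the estimate [Re A(y) >= y / 48] for [y >= 0]
    ([Re_A_lower]).  Since [t^y >= 1 + y ln t] and [cos <= 1], [Re A(y)] is at
    least [y] times the integral of [e^{-t} t ln t / (t+1)], so it suffices that
    this integral be at least [1/48].  Its true value is only about 0.033, while
    the integrand changes sign, so crude estimates fail.  The proof minorizes
    the integrand by the derivative of an elementary function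
    [e^{-t} (S(t) ln t + B(t))], with [S] and [B] rational, which tends to
    [-1/48] at 0 and to 0 at infinity.  After division by the coefficient of
    [ln t], the pointwise inequality becomes [ln t >= (a rational function)],
    with contact at [t = 1] only, and differentiation settles it
    ([ln_ge_rational]). *)

(** * Improper integrals over the positive half-line *)

Definition is_improper (f : R -> R) (l : R) : Prop :=
  is_RInt_gen f (at_right 0) (Rbar_locally p_infty) l.

(** All pointwise facts below hold on the open half-line, so it is enough to look
    at bounds of integration lying on either side of 1; in particular they come
    in increasing order. *)
Lemma near_ends (P : R * R -> Prop) :
  (forall a b, 0 < a < 1 -> 1 < b -> P (a, b)) ->
  filter_prod (at_right 0) (Rbar_locally p_infty) P.
Proof.
intros H.
apply (Filter_prod _ _ _ (fun a => 0 < a < 1) (fun b => 1 < b)).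
- exists (mkposreal 1 Rlt_0_1). intros y Hy Hy0.
  assert (Hy1 : Rabs (y - 0) < 1) by exact Hy.
  apply Rabs_def2 in Hy1. lra.
- exists 1. intros y Hy. exact Hy.
- exact H.
Qed.

Lemma is_improper_ext (f g : R -> R) (l : R) :
  (forall t, 0 < t -> f t = g t) -> is_improper f l -> is_improper g l.
Proof.
intros H Hf. refine (is_RInt_gen_ext f g l _ Hf).
apply near_ends. intros a b Ha Hb t Ht. simpl in Ht.
apply H. rewrite Rmin_left in Ht; lra.
Qed.

Lemma is_improper_unique (f : R -> R) (l l' : R) :
  is_improper f l -> is_improper f l' -> l = l'.
Proof.
intros H H'.
rewrite <- (is_RInt_gen_unique f l H). apply is_RInt_gen_unique. exact H'.
Qed.

Lemma is_improper_plus (f g : R -> R) (lf lg : R) :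
  is_improper f lf -> is_improper g lg ->
  is_improper (fun t => f t + g t) (lf + lg).
Proof. exact (is_RInt_gen_plus f g lf lg). Qed.

Lemma is_improper_scal (f : R -> R) (c l : R) :
  is_improper f l -> is_improper (fun t => c * f t) (c * l).
Proof. exact (is_RInt_gen_scal f c l). Qed.

Lemma is_improper_le (f g : R -> R) (lf lg : R) :
  (forall t, 0 < t -> f t <= g t) ->
  is_improper f lf -> is_improper g lg -> lf <= lg.
Proof.
intros H Hf Hg.
assert (Hd : is_improper (fun t => g t - f t) (lg - lf))
  by exact (is_RInt_gen_minus g f lg lf Hg Hf).
assert (H0 : is_improper (fun t => 0 * f t) (0 * lf))
  by exact (is_improper_scal f 0 lf Hf).
assert (Hn : norm (0 * lf) <= lg - lf).
{ refine (RInt_gen_norm _ _ _ _ _ _ H0 Hd).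
  - apply near_ends. intros a b Ha Hb. simpl. lra.
  - apply near_ends. intros a b Ha Hb t Ht. simpl in Ht.
    rewrite Rmult_0_l. change (Rabs 0 <= g t - f t). rewrite Rabs_R0.
    specialize (H t). lra. }
rewrite Rmult_0_l in Hn. change (Rabs 0 <= lg - lf) in Hn.
rewrite Rabs_R0 in Hn. lra.
Qed.

Lemma is_improper_FTC (F f : R -> R) (l0 l1 : R) :
  (forall t, 0 < t -> is_derive F t (f t)) ->
  (forall t, 0 < t -> continuous f t) ->
  filterlim F (at_right 0) (locally l0) ->
  filterlim F (Rbar_locally p_infty) (locally l1) ->
  is_improper f (l1 - l0).
Proof.
intros HF Hf H0 H1.
apply (is_improper_ext (Derive F)).
{ intros t Ht. apply is_derive_unique. now apply HF. }
refine (is_RInt_gen_Derive F l0 l1 _ _ H0 H1).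
- apply near_ends. intros a b Ha Hb t Ht. simpl in Ht.
  rewrite Rmin_left in Ht by lra. exists (f t). apply HF. lra.
- apply near_ends. intros a b Ha Hb t Ht. simpl in Ht.
  rewrite Rmin_left in Ht by lra.
  apply continuous_ext_loc with f; [|apply Hf; lra].
  assert (Ht0 : 0 < t) by lra.
  exists (mkposreal t Ht0). intros y Hy.
  assert (Hy1 : Rabs (y - t) < t) by exact Hy.
  apply Rabs_def2 in Hy1.
  symmetry. apply is_derive_unique. apply HF. lra.
Qed.

(** The integrals of a nonnegative function grow with the interval, so they
    converge to their supremum along both ends at once. *)
Lemma ex_improper_bounded (f : R -> R) (M : R) :
  (forall t, 0 < t -> continuous f t) ->
  (forall t, 0 < t -> 0 <= f t) ->
  (forall a b, 0 < a <= b -> RInt f a b <= M) ->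
  exists l, is_improper f l.
Proof.
intros Hc H0 HM.
assert (Hex : forall a b, 0 < a -> 0 < b -> ex_RInt f a b).
{ intros a b Ha Hb. apply (ex_RInt_continuous (V := R_CompleteNormedModule)).
  intros z Hz. apply Hc. unfold Rmin in Hz. destruct (Rle_dec a b); lra. }
destruct (completeness (fun y => exists a b, 0 < a <= b /\ y = RInt f a b))
  as [l [Hub Hlub]].
- exists M. intros y (a & b & Hab & ->). now apply HM.
- exists (RInt f 1 1), 1, 1. split; [lra|reflexivity].
- exists l. apply (filterlimi_locally (U := R_UniformSpace)). intros eps.
  assert (Hnub : exists a b, 0 < a <= b /\ l - eps < RInt f a b).
  { apply Classical_Prop.NNPP. intros Hn.
    assert (l <= l - eps); [|destruct eps; simpl in *; lra].
    apply Hlub. intros y (a & b & Hab & ->).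
    apply Rnot_lt_le. intros Hlt. apply Hn. now exists a, b. }
  destruct Hnub as (a & b & Hab & Hl).
  apply (Filter_prod _ _ _ (fun u => 0 < u < a) (fun v => b < v)).
  + assert (Ha : 0 < a) by lra. exists (mkposreal a Ha). intros y Hy Hy0.
    assert (Hy1 : Rabs (y - 0) < a) by exact Hy.
    apply Rabs_def2 in Hy1. lra.
  + exists b. intros y Hy. exact Hy.
  + intros u v Hu Hv. exists (RInt f u v). split.
    { apply (RInt_correct (V := R_CompleteNormedModule)). apply Hex; lra. }
    assert (Hle : RInt f u v <= l) by (apply Hub; exists u, v; split; [lra|reflexivity]).
    assert (E1 : RInt f u a + RInt f a v = RInt f u v)
      by (apply (RInt_Chasles f u a v); apply Hex; lra).
    assert (E2 : RInt f a b + RInt f b v = RInt f a v)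
      by (apply (RInt_Chasles f a b v); apply Hex; lra).
    assert (P1 : 0 <= RInt f u a)
      by (apply RInt_ge_0; [lra|apply Hex; lra|intros; apply H0; lra]).
    assert (P2 : 0 <= RInt f b v)
      by (apply RInt_ge_0; [lra|apply Hex; lra|intros; apply H0; lra]).
    change (Rabs (RInt f u v - l) < eps). apply Rabs_def1; lra.
Qed.

(** [Kurepa_A] is an integral in the complex plane; this lets its real part be
    computed componentwise. *)
Lemma is_RInt_gen_C (f : R -> C) (lr li : R) :
  is_improper (fun t => fst (f t)) lr -> is_improper (fun t => snd (f t)) li ->
  is_RInt_gen (V := C_R_CompleteNormedModule) f
    (at_right 0) (Rbar_locally p_infty) (lr, li).
Proof.
intros Hr Hi.
apply (filterlimi_locally (U := C_R_CompleteNormedModule)). intros eps.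
apply (filterlimi_locally (U := R_UniformSpace)) with (eps := eps) in Hr.
apply (filterlimi_locally (U := R_UniformSpace)) with (eps := eps) in Hi.
generalize (filter_and _ _ Hr Hi). apply filter_imp.
intros [a b] [[u [Hu Bu]] [v [Hv Bv]]]. exists (u, v). split.
- now apply (is_RInt_fct_extend_pair (U := R_NormedModule) (V := R_NormedModule)).
- now split.
Qed.

Lemma lim_at_right_0 (F : R -> R) (C : R) :
  (forall t, 0 < t < 1 -> Rabs (F t) <= C * t) ->
  filterlim F (at_right 0) (locally 0).
Proof.
intros H. apply filterlim_locally. intros [e He].
assert (HC : 0 <= C).
{ specialize (H (/ 2)). generalize (Rabs_pos (F (/ 2))). lra. }
assert (Hd : 0 < Rmin 1 (e / (C + 1))).
{ apply Rmin_pos; [lra|]. apply Rdiv_lt_0_compat; lra. }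
exists (mkposreal _ Hd). intros t Ht Ht0.
assert (Ht1 : Rabs (t - 0) < Rmin 1 (e / (C + 1))) by exact Ht.
apply Rabs_def2 in Ht1.
generalize (Rmin_l 1 (e / (C + 1))), (Rmin_r 1 (e / (C + 1))). intros M1 M2.
change (Rabs (F t - 0) < e). rewrite Rminus_0_r.
apply Rle_lt_trans with (1 := H t ltac:(lra)).
apply Rle_lt_trans with ((C + 1) * t); [nra|].
assert (E : (C + 1) * (e / (C + 1)) = e) by (field; lra).
rewrite <- E. apply Rmult_lt_compat_l; lra.
Qed.

Lemma lim_p_infty_0 (F : R -> R) (C : R) :
  (forall t, 1 < t -> Rabs (F t) <= C / t) ->
  filterlim F (Rbar_locally p_infty) (locally 0).
Proof.
intros H. apply filterlim_locally. intros [e He].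
exists (Rmax 1 (C / e)). intros t Ht.
generalize (Rmax_l 1 (C / e)), (Rmax_r 1 (C / e)). intros M1 M2.
change (Rabs (F t - 0) < e). rewrite Rminus_0_r.
apply Rle_lt_trans with (1 := H t ltac:(lra)).
apply Rmult_lt_reg_r with t; [lra|].
replace (C / t * t) with (C / e * e) by (field; lra). nra.
Qed.

(** * Power moments of the exponential *)

Lemma ln_le_sub_1 (u : R) : 0 < u -> ln u <= u - 1.
Proof. intros Hu. generalize (exp_ineq1_le (ln u)). rewrite exp_ln by trivial. lra. Qed.

(** Half of the exponential decay absorbs any power: apply [ln u <= u - 1] to
    [u = t / (2 s)], the choice for which [s u = t / 2]. *)
Lemma Rpower_exp_bound (s : R) : 0 < s ->
  exists C, 0 < C /\
    forall t, 0 < t -> Rpower t s * exp (- t) <= C * exp (- (t / 2)).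
Proof.
intros Hs. exists (exp (s * (ln (2 * s) - 1))). split; [apply exp_pos|].
intros t Ht. unfold Rpower. rewrite <- !exp_plus.
assert (H : s * ln t + - t <= s * (ln (2 * s) - 1) + - (t / 2)).
{ assert (Hu : 0 < t / (2 * s)) by (apply Rdiv_lt_0_compat; lra).
  generalize (ln_le_sub_1 _ Hu).
  unfold Rdiv. rewrite ln_mult, ln_Rinv; try lra;
    [|apply Rinv_0_lt_compat; lra].
  intros L. apply (Rmult_le_compat_l s) in L; [|lra].
  replace (s * (t * / (2 * s) - 1)) with (t / 2 - s) in L by (field; lra).
  lra. }
destruct H as [H|H]; [left; now apply exp_increasing|rewrite H; right; reflexivity].
Qed.

Lemma exp_half_le (t : R) : 0 < t -> exp (- (t / 2)) <= 2 / t.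
Proof.
intros Ht. rewrite exp_Ropp.
generalize (exp_ineq1_le (t / 2)). intros H.
replace (2 / t) with (/ (t / 2)) by (field; lra).
apply Rinv_le_contravar; lra.
Qed.

Lemma ex_improper_exp_half (f : R -> R) (C : R) :
  (forall t, 0 < t -> continuous f t) ->
  (forall t, 0 < t -> 0 <= f t <= C * exp (- (t / 2))) ->
  exists l, is_improper f l.
Proof.
intros Hc Hb. apply ex_improper_bounded with (2 * C); trivial.
- intros t Ht. now apply Hb.
- intros a b Hab.
  assert (HC : 0 <= C).
  { generalize (Hb 1 Rlt_0_1) (exp_pos (- (1 / 2))). nra. }
  assert (HI : is_RInt (fun t => C * exp (- (t / 2))) a b
     (- 2 * C * exp (- (b / 2)) - - 2 * C * exp (- (a / 2)))).
  { apply (is_RInt_derive (fun t => - 2 * C * exp (- (t / 2)))).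
    - intros t _. auto_derive; trivial. unfold Rdiv. field.
    - intros t _. apply (ex_derive_continuous (V := R_NormedModule)).
      auto_derive; trivial. }
  apply Rle_trans with (RInt (fun t => C * exp (- (t / 2))) a b).
  + apply RInt_le; [lra| |now eexists; apply HI|].
    * apply (ex_RInt_continuous (V := R_CompleteNormedModule)). intros z Hz.
      apply Hc. rewrite Rmin_left in Hz; lra.
    * intros t Ht. apply Hb. lra.
  + rewrite (is_RInt_unique _ _ _ _ HI).
    generalize (exp_pos (- (b / 2))). intros E.
    assert (E1 : exp (- (a / 2)) < 1)
      by (rewrite <- exp_0; apply exp_increasing; lra).
    nra.
Qed.

Lemma is_improper_Gamma (z : R) : 1 < z ->
  is_improper (fun t => Rpower t (z - 1) * exp (- t)) (Gamma z).
Proof.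
intros Hz. unfold is_improper, Gamma. apply (RInt_gen_correct (V := R_CompleteNormedModule)).
destruct (Rpower_exp_bound (z - 1)) as (C & HC & Hb); [lra|].
apply ex_improper_exp_half with C.
- intros t Ht. apply (ex_derive_continuous (V := R_NormedModule)).
  unfold Rpower. auto_derive. exact Ht.
- intros t Ht. split; [|now apply Hb].
  apply Rmult_le_pos; left; apply exp_pos.
Qed.

(** Integration by parts: the difference of the two integrands is the derivative
    of [t^z e^{-t}], which vanishes at both ends. *)
Lemma Gamma_succ (z : R) : 1 < z -> Gamma (z + 1) = z * Gamma z.
Proof.
intros Hz.
assert (H : is_improper
  (fun t => z * (Rpower t (z - 1) * exp (- t)) + -1 * (Rpower t (z + 1 - 1) * exp (- t)))
  (z * Gamma z + -1 * Gamma (z + 1))).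
{ apply is_improper_plus; apply is_improper_scal; apply is_improper_Gamma; lra. }
assert (H' : is_improper
  (fun t => z * (Rpower t (z - 1) * exp (- t)) + -1 * (Rpower t (z + 1 - 1) * exp (- t)))
  (0 - 0)).
{ apply is_improper_FTC with (fun t => Rpower t z * exp (- t)).
  - intros t Ht. unfold Rpower. auto_derive; [exact Ht|].
    replace (z + 1 - 1) with z by ring.
    replace ((z - 1) * ln t) with (z * ln t + - ln t) by ring.
    rewrite exp_plus, (exp_Ropp (ln t)), exp_ln by exact Ht. field. lra.
  - intros t Ht. apply (ex_derive_continuous (V := R_NormedModule)).
    unfold Rpower. auto_derive. easy.
  - apply lim_at_right_0 with 1. intros t Ht.
    rewrite Rabs_pos_eq by (apply Rmult_le_pos; left; apply exp_pos).
    assert (E1 : exp (- t) < 1) by (rewrite <- exp_0; apply exp_increasing; lra).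
    assert (E2 : Rpower t z < t).
    { rewrite <- (exp_ln t) at 2 by lra. unfold Rpower. apply exp_increasing.
      assert (ln t < 0) by (rewrite <- ln_1; apply ln_increasing; lra). nra. }
    generalize (exp_pos (- t)) (exp_pos (z * ln t)). unfold Rpower in *. nra.
  - destruct (Rpower_exp_bound z) as (C & HC & Hb); [lra|].
    apply lim_p_infty_0 with (C * 2). intros t Ht.
    rewrite Rabs_pos_eq by (apply Rmult_le_pos; left; apply exp_pos).
    apply Rle_trans with (1 := Hb t ltac:(lra)).
    unfold Rdiv at 2. rewrite Rmult_assoc.
    apply Rmult_le_compat_l; [lra|]. apply exp_half_le; lra. }
generalize (is_improper_unique _ _ _ H H'). lra.
Qed.

(** * The real part of the alternating Kurepa function *)

Definition Re_A (x : R) : R := Re (Kurepa_A x).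

Lemma ex_improper_kernel (s : R) : 0 < s ->
  exists l, is_improper (fun t => exp (- t) * Rpower t s / (t + 1)) l.
Proof.
intros Hs.
destruct (Rpower_exp_bound s Hs) as (C & HC & Hb).
apply ex_improper_exp_half with C.
- intros t Ht. apply (ex_derive_continuous (V := R_NormedModule)).
  unfold Rpower. auto_derive. repeat split; trivial; lra.
- intros t Ht. specialize (Hb t Ht).
  assert (P : 0 < Rpower t s * exp (- t)) by (apply Rmult_lt_0_compat; apply exp_pos).
  assert (Q : 0 < / (t + 1) <= 1).
  { split; [apply Rinv_0_lt_compat; lra|].
    rewrite <- Rinv_1. apply Rinv_le_contravar; lra. }
  unfold Rdiv. rewrite (Rmult_comm (exp (- t))). nra.
Qed.

Lemma is_improper_Re_A (x : R) : 0 <= x ->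
  is_improper (fun t => exp (- t) * (Rpower t (x + 1) - cos (PI * x) * t) / (t + 1))
    (Re_A x).
Proof.
intros Hx.
destruct (ex_improper_kernel (x + 1)) as [l1 H1]; [lra|].
destruct (ex_improper_kernel 1) as [l2 H2]; [lra|].
assert (Hr : is_improper
  (fun t => exp (- t) * (Rpower t (x + 1) - cos (PI * x) * t) / (t + 1))
  (l1 + (- cos (PI * x)) * l2)).
{ refine (is_improper_ext _ _ _ _
    (is_improper_plus _ _ _ _ H1 (is_improper_scal _ _ _ H2))).
  intros t Ht. simpl. rewrite Rpower_1 by exact Ht. field. lra. }
assert (Hi : is_improper (fun t => - sin (PI * x) * (exp (- t) * Rpower t 1 / (t + 1)))
  (- sin (PI * x) * l2)) by now apply is_improper_scal.
enough (E : Re_A x = l1 + - cos (PI * x) * l2) by (rewrite E; exact Hr).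
unfold Re_A, Kurepa_A.
erewrite (is_RInt_gen_unique (V := C_R_CompleteNormedModule));
  [|apply is_RInt_gen_C].
- reflexivity.
- refine (is_improper_ext _ _ _ _ Hr). intros t Ht. simpl.
  replace (0 * (PI * x) - 1 * 0) with 0 by ring. rewrite exp_0.
  replace (0 * 0 + 1 * (PI * x)) with (PI * x) by ring. field. nra.
- refine (is_improper_ext _ _ _ _ Hi). intros t Ht. simpl.
  replace (0 * (PI * x) - 1 * 0) with 0 by ring. rewrite exp_0.
  replace (0 * 0 + 1 * (PI * x)) with (PI * x) by ring.
  rewrite Rpower_1 by exact Ht. field. nra.
Qed.

(** [cos (pi (x-1)) = - cos (pi x)] cancels the correction terms, and
    [t^{x+1} + t^x = t^x (t+1)] cancels the denominator. *)
Lemma Re_A_succ (x : R) : 1 <= x -> Re_A x = Gamma (x + 1) - Re_A (x - 1).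
Proof.
intros Hx.
assert (H : is_improper (fun t => Rpower t (x + 1 - 1) * exp (- t)) (Re_A x + Re_A (x - 1))).
{ refine (is_improper_ext _ _ _ _ (is_improper_plus _ _ _ _
    (is_improper_Re_A x _) (is_improper_Re_A (x - 1) _))); try lra.
  intros t Ht. simpl.
  replace (PI * (x - 1)) with (- (PI - PI * x)) by ring.
  rewrite cos_neg, Rtrigo_facts.cos_pi_minus.
  replace (x + 1 - 1) with x by ring. replace (x - 1 + 1) with x by ring.
  rewrite Rpower_plus, Rpower_1 by exact Ht. field. lra. }
assert (H' : is_improper (fun t => Rpower t (x + 1 - 1) * exp (- t)) (Gamma (x + 1)))
  by (apply is_improper_Gamma; lra).
generalize (is_improper_unique _ _ _ H H'). lra.
Qed.

Lemma Re_A_0 : Re_A 0 = 0.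
Proof.
assert (H := is_improper_Re_A 0 (Rle_refl 0)).
assert (H0 := is_improper_scal _ 0 _ H).
transitivity (0 * Re_A 0); [|ring].
apply (is_improper_unique _ _ _ H).
refine (is_improper_ext _ _ _ _ H0). intros t Ht.
rewrite Rmult_0_r, cos_0, Rplus_0_l, Rpower_1 by exact Ht. field. lra.
Qed.

(** * Positivity of the logarithmic moment *)

(** The difference [D] of the two sides vanishes at 1, and its derivative has
    the sign of [t - 1] because the cofactor of [t - 1] in the numerator is
    positive; hence [D] is minimal at 1. *)
Lemma ln_ge_rational (t : R) : 0 < t ->
  - ((1 + t) * (3 + 125 * t - 59 * t ^ 2 - 69 * t ^ 3)
     / (16 * (t * (3 + 12 * t + 8 * t ^ 2 + 2 * t ^ 3)))) <= ln t.
Proof.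
intros Ht.
set (D := fun t => ln t + (1 + t) * (3 + 125 * t - 59 * t ^ 2 - 69 * t ^ 3)
     / (16 * (t * (3 + 12 * t + 8 * t ^ 2 + 2 * t ^ 3)))).
set (D' := fun t =>
  (t - 1) * ((9 - 63 * t + 195 * t ^ 2 - 37 * t ^ 3 + 152 * t ^ 4
              + 280 * t ^ 5 + 64 * t ^ 6)
             / (16 * (t * (3 + 12 * t + 8 * t ^ 2 + 2 * t ^ 3)) ^ 2))).
assert (HT : forall u, 0 < u -> 0 < u * (3 + 12 * u + 8 * u ^ 2 + 2 * u ^ 3)).
{ intros u Hu. assert (0 < u ^ 2) by nra. assert (0 < u ^ 3) by (apply pow_lt; lra). nra. }
assert (HD : forall u, 0 < u -> is_derive D u (D' u)).
{ intros u Hu. specialize (HT u Hu). unfold D, D'. auto_derive.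
  - repeat split; trivial. apply Rgt_not_eq. simpl in HT. lra.
  - field. split; [|lra]. intros E. rewrite E in HT. lra. }
assert (H1 : D 1 = 0) by (unfold D; rewrite ln_1; field).
destruct (MVT_gen D 1 t D') as (c & Hc & E).
- intros u Hu. apply HD. unfold Rmin in Hu. destruct (Rle_dec 1 t); lra.
- intros u Hu. apply continuity_pt_filterlim.
  apply (ex_derive_continuous (V := R_NormedModule)). exists (D' u). apply HD.
  unfold Rmin in Hu. destruct (Rle_dec 1 t); lra.
- assert (Hc0 : 0 < c) by (unfold Rmin in Hc; destruct (Rle_dec 1 t); lra).
  assert (Hcs : 0 <= (c - 1) * (t - 1)).
  { unfold Rmin, Rmax in Hc; destruct (Rle_dec 1 t); nra. }
  assert (HP : 0 < 9 - 63 * c + 195 * c ^ 2 - 37 * c ^ 3 + 152 * c ^ 4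
              + 280 * c ^ 5 + 64 * c ^ 6).
  { assert (0 < c ^ 5) by (apply pow_lt; lra).
    assert (0 < c ^ 6) by (apply pow_lt; lra).
    (* With [195 = 120 + 75], both quadratic factors have negative discriminant. *)
    assert (0 < 9 - 63 * c + 120 * c ^ 2).
    { assert (0 <= (63 * c - 18) ^ 2) by apply pow2_ge_0. nra. }
    assert (0 <= c ^ 2 * (75 - 37 * c + 152 * c ^ 2)).
    { apply Rmult_le_pos; [apply pow2_ge_0|]. 
      assert (0 <= (37 * c - 150) ^ 2) by apply pow2_ge_0. nra. }
    lra. }
  assert (0 <= D t); [|unfold D in *; lra].
  rewrite H1 in E. replace (D t) with (D' c * (t - 1)) by lra.
  unfold D'. specialize (HT c Hc0).
  match goal with |- context [?a / ?b] => assert (0 < a / b) end.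
  { apply Rdiv_lt_0_compat; [exact HP|].
    apply Rmult_lt_0_compat; [lra|]. apply pow_lt. exact HT. }
  nra.
Qed.

(** [log_part] and [rational_part] are [e^{-t} S(t) ln t] and [e^{-t} B(t)].
    With [S = - (1/3) (t / (1+t))^3], the coefficient of [ln t] in
    [e^{-t} t ln t / (t+1) - (e^{-t} (S ln t + B))'] is positive for all [t > 0].
    For [B = b0 + b1 / (1+t) + b2 / (1+t)^2], requiring this difference to vanish
    to second order at [t = 1] gives [b1 = 13/12 - 5 b2 / 4] and
    [b0 = - 41/48 + 7 b2 / 16], so [B(0) = 11/48 + 3 b2 / 16].  The value
    [b2 = - 4/3] makes [B(0)] negative and keeps the difference
    nonnegative on the whole half-line. *)
Definition log_part (t : R) : R := - (1 / 3) * (t / (1 + t)) ^ 3 * ln t * exp (- t).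

Definition rational_part (t : R) : R :=
  (- (23 / 16) + 11 / 4 / (1 + t) - 4 / 3 / (1 + t) ^ 2) * exp (- t).

(** The derivative of [log_part + rational_part]. *)
Definition log_minorant (t : R) : R :=
  exp (- t) *
  ((t ^ 3 / (3 * (1 + t) ^ 3) - t ^ 2 / (1 + t) ^ 4) * ln t - t ^ 2 / (3 * (1 + t) ^ 3)
   + 23 / 16 - 11 / 4 / (1 + t) + (4 / 3 - 11 / 4) / (1 + t) ^ 2 + 8 / 3 / (1 + t) ^ 3).

Lemma is_derive_log_minorant (t : R) : 0 < t ->
  is_derive (fun t => log_part t + rational_part t) t (log_minorant t).
Proof.
intros Ht. unfold log_part, rational_part, log_minorant. auto_derive.
- repeat split; trivial; try (apply Rgt_not_eq); try lra; nra.
- field. lra.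
Qed.

(** The difference of the two sides is a positive multiple of the difference in
    [ln_ge_rational]. *)
Lemma log_minorant_le (t : R) : 0 < t ->
  log_minorant t <= exp (- t) * t * ln t / (t + 1).
Proof.
intros Ht. unfold log_minorant.
assert (L := ln_ge_rational t Ht).
assert (H2 : 0 < t ^ 2) by (apply pow_lt; lra).
assert (H3 : 0 < t ^ 3) by (apply pow_lt; lra).
set (K := (1 + t) * (3 + 125 * t - 59 * t ^ 2 - 69 * t ^ 3)
     / (16 * (t * (3 + 12 * t + 8 * t ^ 2 + 2 * t ^ 3)))) in L.
assert (HM : 0 < exp (- t) * (t * (3 + 12 * t + 8 * t ^ 2 + 2 * t ^ 3) / (3 * (1 + t) ^ 4))).
{ apply Rmult_lt_0_compat; [apply exp_pos|]. apply Rdiv_lt_0_compat.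
  - apply Rmult_lt_0_compat; lra.
  - apply Rmult_lt_0_compat; [lra|]. apply pow_lt; lra. }
match goal with |- ?l <= ?r => assert (E : r - l =
  exp (- t) * (t * (3 + 12 * t + 8 * t ^ 2 + 2 * t ^ 3) / (3 * (1 + t) ^ 4)) * (ln t + K)) end.
{ unfold K. field. split; [lra|]. simpl in *. lra. }
assert (HL : 0 <= ln t + K) by lra.
assert (H := Rmult_le_pos _ _ (Rlt_le _ _ HM) HL). lra.
Qed.

Lemma continuous_log_minorant (t : R) : 0 < t -> continuous log_minorant t.
Proof.
intros Ht. apply (ex_derive_continuous (V := R_NormedModule)).
unfold log_minorant. auto_derive.
repeat split; trivial; apply Rgt_not_eq; try lra; repeat apply Rmult_lt_0_compat; lra.
Qed.

Lemma ratio_cube_bounds (t : R) : 0 < t -> 0 < (t / (1 + t)) ^ 3 <= t ^ 2 /\ (t / (1 + t)) ^ 3 <= 1.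
Proof.
intros Ht.
assert (Hq : 0 < t / (1 + t)) by (apply Rdiv_lt_0_compat; lra).
assert (E : t = t / (1 + t) * (1 + t)) by (field; lra).
set (q := t / (1 + t)) in *. assert (q < 1) by nra. assert (q < t) by nra.
assert (q ^ 2 < t ^ 2) by (simpl; nra). assert (0 < q ^ 2 < 1) by (simpl; nra).
simpl in *. nra.
Qed.

(** The antiderivative vanishes at infinity; at 0 its logarithmic part vanishes
    and its rational part equals [-23/16 + 11/4 - 4/3 = -1/48]. *)
Lemma is_improper_log_minorant : is_improper log_minorant (1 / 48).
Proof.
replace (1 / 48) with (0 - (0 + - (1 / 48))) by field.
apply is_improper_FTC with (fun t => log_part t + rational_part t).
- exact is_derive_log_minorant.
- exact continuous_log_minorant.
- apply (filterlim_comp_2 (G := locally 0) (H := locally (- (1 / 48)))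
    log_part rational_part Rplus).
  + apply lim_at_right_0 with 1. intros t Ht. unfold log_part.
    destruct (ratio_cube_bounds t) as [[Q0 Q1] _]; [lra|].
    assert (L1 : ln t < 0) by (rewrite <- ln_1; apply ln_increasing; lra).
    assert (L2 : - ln t <= / t - 1).
    { rewrite <- ln_Rinv by lra. apply ln_le_sub_1. apply Rinv_0_lt_compat; lra. }
    assert (L3 : t * - ln t <= 1).
    { apply Rmult_le_compat_l with (r := t) in L2; [|lra].
      rewrite Rmult_minus_distr_l, Rinv_r in L2; lra. }
    assert (E0 := exp_pos (- t)).
    assert (E1 : exp (- t) < 1) by (rewrite <- exp_0; apply exp_increasing; lra).
    set (q := (t / (1 + t)) ^ 3) in *.
    replace (- (1 / 3) * q * ln t * exp (- t)) with (1 / 3 * (q * - ln t) * exp (- t)) by ring.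
    assert (A : 0 <= q * - ln t <= t).
    { split; [nra|]. apply Rle_trans with (t ^ 2 * - ln t); [nra|simpl; nra]. }
    rewrite Rabs_pos_eq; nra.
  + replace (- (1 / 48)) with (rational_part 0)
      by (unfold rational_part; rewrite Ropp_0, exp_0; field).
    apply (filterlim_filter_le_1 (F := locally 0) rational_part).
    { apply filter_le_within. }
    apply (ex_derive_continuous (V := R_NormedModule)).
    unfold rational_part. auto_derive. repeat split; trivial; lra.
  + exact (filterlim_plus 0 (- (1 / 48))).
- apply lim_p_infty_0 with 100. intros t Ht.
  destruct (ratio_cube_bounds t) as [[Q0 _] Q1]; [lra|].
  assert (L1 : 0 < ln t) by (rewrite <- ln_1; apply ln_increasing; lra).
  assert (L2 : ln t < t) by (generalize (ln_le_sub_1 t); lra).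
  assert (I : 0 < / (1 + t) < 1).
  { split; [apply Rinv_0_lt_compat; lra|]. rewrite <- Rinv_1. apply Rinv_lt_contravar; lra. }
  assert (E0 := exp_pos (- t)).
  assert (E : exp (- t) <= 4 / t ^ 2).
  { assert (H := exp_half_le t ltac:(lra)). assert (P := exp_pos (- (t / 2))).
    replace (- t) with (- (t / 2) + - (t / 2)) by field. rewrite exp_plus.
    replace (4 / t ^ 2) with (2 / t * (2 / t)) by (field; lra). nra. }
  replace (log_part t + rational_part t) with
    ((- (1 / 3) * ((t / (1 + t)) ^ 3 * ln t)
      + (- (23 / 16) + 11 / 4 * / (1 + t) - 4 / 3 * (/ (1 + t) * / (1 + t)))) * exp (- t))
    by (unfold log_part, rational_part; field; lra).
  set (q := (t / (1 + t)) ^ 3) in *. set (i := / (1 + t)) in *.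
  assert (A : 0 <= q * ln t <= t) by nra. assert (B : 0 <= i * i <= 1) by nra.
  rewrite Rabs_mult, (Rabs_pos_eq (exp (- t))) by lra.
  apply Rle_trans with (25 * t * (4 / t ^ 2)); [|right; field; lra].
  apply Rmult_le_compat; [apply Rabs_pos|lra| |exact E].
  apply Rabs_le. lra.
Qed.

(** Convexity of [t^y] in [y] reduces the whole family of integrals to the
    single logarithmic one. *)
Lemma Re_A_lower (y : R) : 0 <= y -> y / 48 <= Re_A y.
Proof.
intros Hy. replace (y / 48) with (y * (1 / 48)) by field.
refine (is_improper_le _ _ _ _ _ (is_improper_scal _ y _ is_improper_log_minorant)
  (is_improper_Re_A y Hy)).
intros t Ht. simpl.
apply Rle_trans with (y * (exp (- t) * t * ln t / (t + 1))).
{ apply Rmult_le_compat_l; [exact Hy|]. now apply log_minorant_le. }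
assert (W : 0 < exp (- t) * t / (t + 1)).
{ apply Rdiv_lt_0_compat; [|lra]. apply Rmult_lt_0_compat; [apply exp_pos|lra]. }
rewrite Rpower_plus, Rpower_1 by exact Ht.
replace (y * (exp (- t) * t * ln t / (t + 1)))
  with (exp (- t) * t / (t + 1) * (y * ln t)) by (field; lra).
replace (exp (- t) * (Rpower t y * t - cos (PI * y) * t) / (t + 1))
  with (exp (- t) * t / (t + 1) * (Rpower t y - cos (PI * y))) by (field; lra).
apply Rmult_le_compat_l; [lra|].
generalize (exp_ineq1_le (y * ln t)) (COS_bound (PI * y)). unfold Rpower. lra.
Qed.

(** [Gamma z] is the sum of [Re A(z-1) >= (z-1) / 48 > 0] and
    [Re A(z-2) >= 0]. *)
Lemma Gamma_pos (z : R) : 2 <= z -> 0 < Gamma z.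
Proof.
intros Hz. assert (E := Re_A_succ (z - 1) ltac:(lra)).
replace (z - 1 + 1) with z in E by ring.
generalize (Re_A_lower (z - 1) ltac:(lra)) (Re_A_lower (z - 1 - 1) ltac:(lra)). lra.
Qed.

(** * Unrolling the recurrence *)

Lemma Re_A_unroll (m : nat) (x : R) : INR (S m) <= x ->
  Re_A x = Gamma (x + 2 - INR (S m)) * p m x + (-1) ^ S m * Re_A (x - INR (S m)).
Proof.
induction m as [|m IH]; intros Hx.
- simpl in *. rewrite Re_A_succ by lra.
  replace (x + 2 - 1) with (x + 1) by ring. ring.
- rewrite S_INR in Hx. rewrite IH by lra.
  assert (Hm := pos_INR (S m)).
  assert (G := Gamma_succ (x + 2 - INR (S (S m)))).
  rewrite (S_INR (S m)) in *.
  replace (x + 2 - (INR (S m) + 1) + 1) with (x + 2 - INR (S m)) in G by ring.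
  rewrite G by lra.
  rewrite (Re_A_succ (x - INR (S m))) by lra.
  replace (x - INR (S m) + 1) with (x + 2 - (INR (S m) + 1)) by ring.
  replace (x - INR (S m) - 1) with (x - (INR (S m) + 1)) by ring.
  change (p (S m) x) with ((x - INR (S m) + 1) * p m x + (-1) ^ S m).
  change ((-1) ^ S (S m)) with (-1 * (-1) ^ S m). ring.
Qed.

(** The sums [s_m] of the first [m] terms [(-1)^j Gamma(x+1-j)] satisfy
    [s_m - s_{m-1} = (-1)^(m-1) Gamma(x+2-m)]; the functional equation of [Gamma]
    turns this into the recurrence of order two that defines [r]. *)
Lemma r_Gamma (m : nat) (x : R) : INR (S m) <= x ->
  r (S m) x * Gamma (x + 2) = (-1) ^ S m * Gamma (x + 2 - INR (S m)) * p m x.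
Proof.
(* The recurrence has order two, so two consecutive indices are carried along. *)
enough (H : INR (S m) <= x ->
  r (S m) x * Gamma (x + 2) = (-1) ^ S m * Gamma (x + 2 - INR (S m)) * p m x /\
  (INR (S (S m)) <= x ->
   r (S (S m)) x * Gamma (x + 2) = (-1) ^ S (S m) * Gamma (x + 2 - INR (S (S m))) * p (S m) x))
  by (intros Hx; now apply H).
induction m as [|m IH]; intros Hx.
- assert (G := Gamma_succ (x + 1)). replace (x + 1 + 1) with (x + 2) in G by ring.
  simpl in *. rewrite G by lra. split.
  + replace (x + 2 - 1) with (x + 1) by ring. field. lra.
  + intros Hx2. replace (x + 2 - (1 + 1)) with x by ring.
    rewrite Gamma_succ by lra. field. lra.
- assert (Hm := pos_INR m).
  destruct IH as [IH1 IH2]; [rewrite !S_INR in *; lra|].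
  specialize (IH2 Hx). split; [exact IH2|]. intros Hx3.
  change (r (S (S (S m))) x) with
    (- ((x - INR (S (S (S m))) + 1) / (x - INR (S (S (S m))) + 2)) * r (S (S m)) x
     + 1 / (x - INR (S (S (S m))) + 2) * r (S m) x).
  rewrite Rmult_plus_distr_r, !Rmult_assoc, IH1, IH2.
  change (p (S (S m)) x) with ((x - INR (S (S m)) + 1) * p (S m) x + (-1) ^ S (S m)).
  change (p (S m) x) with ((x - INR (S m) + 1) * p m x + (-1) ^ S m).
  rewrite !S_INR in *.
  assert (G1 := Gamma_succ (x + 2 - (INR m + 1 + 1 + 1)) ltac:(lra)).
  replace (x + 2 - (INR m + 1 + 1 + 1) + 1) with (x + 2 - (INR m + 1 + 1)) in G1 by ring.
  assert (G2 := Gamma_succ (x + 2 - (INR m + 1 + 1)) ltac:(lra)).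
  replace (x + 2 - (INR m + 1 + 1) + 1) with (x + 2 - (INR m + 1)) in G2 by ring.
  rewrite G2, G1.
  change ((-1) ^ S (S (S m))) with (-1 * (-1 * (-1) ^ S m)).
  change ((-1) ^ S (S m)) with (-1 * (-1) ^ S m).
  field. lra.
Qed.

Lemma p_ge_1 (m : nat) (x : R) : INR (S m) <= x -> 1 <= p m x.
Proof.
induction m as [|m IH]; intros Hx; [simpl; lra|].
rewrite S_INR in Hx. specialize (IH ltac:(lra)).
change (p (S m) x) with ((x - INR (S m) + 1) * p m x + (-1) ^ S m).
assert (-1 <= (-1) ^ S m).
{ generalize (pow_1_abs (S m)). intros A. generalize (Rle_abs (- (-1) ^ S m)).
  rewrite Rabs_Ropp, A. lra. }
nra.
Qed.

Theorem theorem7 (n k : nat) (hn : (0 < n)%nat) (hk : k = (2 * n)%nat) :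
  (forall x : R, INR k + 1 <= x ->
     r k x < Re (Kurepa_A x) / Gamma (x + 2) /\
     Re (Kurepa_A x) / Gamma (x + 2) <= p k x / (p k x - 1) * r k x)
  /\
  (forall x : R, x = INR k + 1 ->
     Re (Kurepa_A x) / Gamma (x + 2) = p k x / (p k x - 1) * r k x).
Proof.
assert (Hsign : (-1) ^ k = 1) by (rewrite hk; apply pow_1_even).
destruct k as [|m]; [lia|]. clear hk.
(* The last equation exhibits the upper bound as [Re A(x) + Re A(y-1)] with
   [y = x - k]. *)
assert (Hmain : forall x, INR (S m) + 1 <= x ->
  let G := Gamma (x + 2) in
  0 < G /\
  Re_A x = r (S m) x * G + Re_A (x - INR (S m)) /\
  p (S m) x / (p (S m) x - 1) * r (S m) x * G
  = r (S m) x * G + Re_A (x - INR (S m)) + Re_A (x - INR (S m) - 1)).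
{ intros x Hx G. assert (Hm := pos_INR (S m)).
  assert (HG : 0 < G) by (apply Gamma_pos; lra).
  assert (HU := Re_A_unroll m x ltac:(lra)).
  assert (HR := r_Gamma m x ltac:(lra)). fold G in HR.
  rewrite Hsign in *.
  split; [exact HG|]. split; [lra|].
  assert (HP := p_ge_1 m x ltac:(lra)).
  assert (E := Re_A_succ (x - INR (S m)) ltac:(lra)).
  assert (G1 := Gamma_succ (x - INR (S m) + 1) ltac:(lra)).
  replace (x - INR (S m) + 1 + 1) with (x + 2 - INR (S m)) in G1 by ring.
  rewrite Rmult_assoc, HR.
  replace (Re_A (x - INR (S m))) with (Gamma (x - INR (S m) + 1) - Re_A (x - INR (S m) - 1))
    by (symmetry; exact E).
  change (p (S m) x) with ((x - INR (S m) + 1) * p m x + (-1) ^ S m).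
  rewrite Hsign, G1. field. apply Rgt_not_eq. nra. }
split; intros x Hx; destruct (Hmain x ltac:(lra)) as (HG & HA & HB);
  fold (Re_A x); set (G := Gamma (x + 2)) in *; set (y := x - INR (S m)) in *.
- assert (L1 := Re_A_lower y ltac:(unfold y; lra)).
  assert (L0 := Re_A_lower (y - 1) ltac:(unfold y; lra)).
  assert (1 <= y) by (unfold y; lra).
  split.
  + apply Rmult_lt_reg_r with G; [exact HG|]. unfold Rdiv.
    rewrite Rmult_assoc, Rinv_l; lra.
  + apply Rmult_le_reg_r with G; [exact HG|]. rewrite HB. unfold Rdiv.
    rewrite Rmult_assoc, Rinv_l; lra.
- replace (y - 1) with 0 in HB by (unfold y; lra).
  rewrite Re_A_0 in HB.
  apply Rmult_eq_reg_r with G; [|lra]. rewrite HB. unfold Rdiv.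
  rewrite Rmult_assoc, Rinv_l; lra.
Qed.
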